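(* Let $\lambda\in(\tfrac12,1)$. Then the Bernoulli convolution $\nu_\lambda$ is invariant under the map $\phi_\lambda:[0,1]\to[0,1]$, i.e. $\nu_\lambda(\phi_\lambda^{-1}(A))=\nu_\lambda(A)$ for every Borel set $A\subset[0,1]$.
   Context: For $\lambda\in(\tfrac12,1)$, the Bernoulli convolution $\nu_\lambda$ is the Borel probability measure on $[0,1]$ given by the distribution of the random series $(\lambda^{-1}-1)\sum_{i=1}^\infty a_i\lambda^i$, where the digits $a_i$ are chosen independently from $\{0,1\}$, each value with probability $\tfrac12$. Its distribution function is $F_\lambda:[0,1]\to[0,1]$, $F_\lambda(x)=\nu_\lambda[0,x]$. Since $\nu_\lambda$ is non-atomic and fully supported on $[0,1]$, $F_\lambda$ is a strictly increasing continuous bijection of $[0,1]$, with inverse $F_\lambda^{-1}$; moreover $F_\lambda(\tfrac12)=\tfrac12$. The map $\phi_\lambda:[0,1]\to[0,1]$ is defined by $\phi_\lambda(x)=F_\lambda^{-1}(2F_\lambda(x))$ for $x\in[0,\tfrac12]$ and $\phi_\lambda(x)=F_\lambda^{-1}(2F_\lambda(1-x))$ for $x\in[\tfrac12,1]$. *)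

(* Defs.v *)
From HB Require Import structures.
From mathcomp Require Import all_boot all_order all_algebra finmap.
From mathcomp Require Import all_classical all_reals all_analysis measurable_realfun.
Import Order.TTheory GRing.Theory Num.Theory.
Import numFieldNormedType.Exports.

Set Implicit Arguments.
Unset Strict Implicit.
Unset Printing Implicit Defensive.

Local Open Scope classical_set_scope.
Local Open Scope ring_scope.

Definition mutually_independent d d' (T : measurableType d)
    (T' : measurableType d') (R : realType) (P : probability T R)
    (I : choiceType) (X : I -> {RV P >-> T'}) : Prop :=
  forall (J : {fset I}) (B : I -> set T'), (forall i, measurable (B i)) ->
    P (\bigcap_(i in [set` J]) X i @^-1` B i) =
    (\prod_(i <- J) P (X i @^-1` B i))%E.

Definition fair_digits d (T : measurableType d) (R : realType)
    (P : probability T R) (a : nat -> {RV P >-> bool}) : Prop :=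
  (forall i b, P (a i @^-1` [set b]) = (2^-1 : R)%:E) /\
  mutually_independent a.

Section bernoulli_convolution.
Context d (T : measurableType d) (R : realType) (P : probability T R).
Variables (lambda : R) (a : nat -> {RV P >-> bool}).

(* [a i] is the digit with index [i.+1] in the usual numbering from 1, whence
   the exponent [i.+1]. *)
Definition bernoulli_series (w : T) : R :=
  (lambda^-1 - 1) * limn [series (a i w)%:R * lambda ^+ i.+1]_i.

Hypothesis hlambda : 2^-1 < lambda < 1.

Lemma measurable_bernoulli_series : measurable_fun setT bernoulli_series.
Proof.
apply: measurable_funM => //.
pose u (w : T) (i : nat) : R := (a i w)%:R * lambda ^+ i.+1.
apply: (@measurable_fun_cvg _ _ _ _ (fun n w => series (u w) n)).
  move=> n; apply: measurable_sum => i; apply: measurable_funM => //.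
  have -> : (fun w => (a i w)%:R) = (fun b : bool => b%:R : R) \o a i by [].
  exact: measurableT_comp.
move=> w _; have /andP[l2 l1] := hlambda.
have l0 : 0 < lambda by apply: lt_trans l2; rewrite invr_gt0.
suff : cvgn (series (u w)) by [].
apply: (@series_le_cvg _ _ (geometric lambda lambda)) => [n|n|n|].
- by rewrite mulr_ge0// exprn_ge0// ltW.
- by rewrite mulr_ge0 ?exprn_ge0// ltW.
- by rewrite /u /= -exprS ler_piMl ?exprn_ge0 ?(ltW l0)//; case: (a n w).
- by apply: is_cvg_geometric_series; rewrite gtr0_norm.
Qed.

HB.instance Definition _ :=
  isMeasurableFun.Build _ _ _ _ bernoulli_series measurable_bernoulli_series.

Definition bernoulli_convolution : probability R R :=
  distribution P bernoulli_series.

End bernoulli_convolution.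

Section phi_map.
Context (R : realType) (nu : probability R R).

Definition distribution_function (x : R) : R := fine (nu `[0, x]%classic).

(* Any other choice of inverse on [0, 1] agrees with this one when
   [distribution_function] is a bijection of [0, 1]. *)
Definition distribution_function_inv : R -> R :=
  pinv (`[0, 1] : set R) distribution_function.

Definition phi (x : R) : R :=
  if x <= 2^-1 then distribution_function_inv (2 * distribution_function x)
  else distribution_function_inv (2 * distribution_function (1 - x)).

End phi_map.

(* Main.v *)
Require Import Defs.
From HB Require Import structures.
From mathcomp Require Import all_boot all_order all_algebra finmap.
From mathcomp Require Import all_classical all_reals all_analysis.
From mathcomp Require Import measurable_realfun ring lra.
Import Order.TTheory GRing.Theory Num.Theory.
Import numFieldNormedType.Exports.
Local Open Scope classical_set_scope.
Local Open Scope ring_scope.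

(** Let [F] be the distribution function of the measure [nu]. In the
coordinate [F x] the map [phi] is the full tent map [u |-> 2 * min u (1 - u)]
and [nu] is Lebesgue measure, which the tent map preserves. For a law on the
unit interval this only takes that [F] is continuous, strictly increasing
there, and symmetric, [F (1 - x) = 1 - F x]. Indeed, for [0 < t <= 1] there is
then [s <= 1/2] with [F s = F t / 2], and [phi x < t] holds exactly when [x <
s] or [1 - s < x] ([phi_lt]); each of these two rays has measure [F t / 2].
Open rays determine a finite measure on the line ([phi_invariant]).

The three properties of [F] come from the digits.  Write [c = 1 - lambda], so
that the series with digits [s 0], [s 1], and so on, is [c * s 0] plus
[lambda] times the series of the shifted digits.  By independence, the partial
sums of length [n] have a distribution function [digit_cdf n] given by a
recursion in [n] in which the digits no longer appear ([prob_digit_sum_le]).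
Partial sums increase to the series, so [F] is the pointwise limit of
[digit_cdf n] ([bernoulli_cdf_cvg]).

- The law thus depends only on the digits being fair.  Negating all digits
  keeps them fair and replaces the series by [1] minus the series; this is the
  symmetry ([bernoulli_cdf_sym]).
- In the limit, [F x = (F (x / lambda) + F ((x - c) / lambda)) / 2]
  ([bernoulli_cdf_split]), from which the other two properties follow.
- Continuity: flipping the digit of index [k] moves the series by exactly
  [c * lambda ^+ k], so the mass near [x] is at most the mass near
  [x + c * lambda ^+ k] plus the mass near [x - c * lambda ^+ k]
  ([increment_le_shift]).  For varying [k] these places are disjoint, so that
  a total mass [1] leaves little for each of them ([increment_small]).
- Strict monotonicity: the maps [x |-> x / lambda] and [x |-> (x - c) / lambda]
  are expanding, so an interval of mass zero yields longer and longer ones,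
  until one of them reaches [1], near which there is mass
  ([self_similar_increasing]).  Here [1/2 < lambda] matters: it lets the
  images of the unit interval under the inverse maps overlap. *)

Set Implicit Arguments.
Unset Strict Implicit.

(** * Distribution functions of self-similar measures *)

Section self_similar.
Variables (R : realType) (lambda : R) (G : R -> R).
Hypothesis lambda_gt : 2^-1 < lambda.
Hypothesis lambda_lt1 : lambda < 1.
Hypothesis G_ndecr : {homo G : x y / x <= y}.
Hypothesis G_lt0 : forall x, x < 0 -> G x = 0.
Hypothesis G_ge1 : forall x, 1 <= x -> G x = 1.
(** Conditioning on the first digit, which is [0] or [1] with equal
probability. *)
Hypothesis G_split : forall x,
  G x = (G (x / lambda) + G ((x - (1 - lambda)) / lambda)) / 2.

Let lambda_gt0 : 0 < lambda.
Proof. by apply: lt_trans lambda_gt; rewrite invr_gt0. Qed.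

Let G_ge0 x : 0 <= G x.
Proof.
have [x0|x0] := ltP x 0; first by rewrite G_lt0.
rewrite -(@G_lt0 (- 1)) ?oppr_lt0 //; apply: G_ndecr.
by apply: le_trans x0; rewrite oppr_le0.
Qed.

Let G_le1 x : G x <= 1.
Proof.
have [x1|/ltW x1] := leP 1 x; first by rewrite G_ge1.
by rewrite -(@G_ge1 1) //; exact: G_ndecr.
Qed.

(** For the law of the series this is the effect of flipping the digit of index
[k].  On the level of [G], the two terms that the splitting identity gives for
[x] occur among those that it gives for [x + c] and [x - c], where
[c = 1 - lambda]: this is the case [k = 0].  Every further use of the identity
divides distances by [lambda]. *)
Lemma increment_le_shift k x h (e := (1 - lambda) * lambda ^+ k) : 0 <= h ->
  G x - G (x - h) <= (G (x + e) - G (x + e - h)) + (G (x - e) - G (x - e - h)).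
Proof.
have l0 : lambda != 0 by rewrite gt_eqF.
rewrite {}/e; elim: k x h => [|k IH] x h h0.
  rewrite expr0 mulr1 (G_split x) (G_split (x - h)).
  rewrite (G_split (x + _)) (G_split (x + _ - h)).
  rewrite (G_split (x - (1 - lambda))) (G_split (x - (1 - lambda) - h)).
  have mono y z : y <= z -> G (y / lambda) <= G (z / lambda).
    by move=> yz; apply: G_ndecr; rewrite ler_pM2r ?invr_gt0.
  have -> : x + (1 - lambda) - (1 - lambda) = x by ring.
  have -> : x + (1 - lambda) - h - (1 - lambda) = x - h by ring.
  have -> : x - h - (1 - lambda) = x - (1 - lambda) - h by ring.
  have := mono (x + (1 - lambda) - h) (x + (1 - lambda)).
  have := mono (x - (1 - lambda) - h - (1 - lambda)) (x - (1 - lambda) - (1 - lambda)).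
  move=> H1 H2; move: (H1 ltac:(lra)) (H2 ltac:(lra)) => {H1 H2}.
  lra.
have h'0 : 0 <= h / lambda by rewrite divr_ge0 // ltW.
have H1 := IH (x / lambda) _ h'0.
have H2 := IH ((x - (1 - lambda)) / lambda) _ h'0.
rewrite (G_split x) (G_split (x - h)).
set e := (1 - lambda) * lambda ^+ k.+1.
rewrite (G_split (x + e)) (G_split (x + e - h)).
rewrite (G_split (x - e)) (G_split (x - e - h)).
have eE : (1 - lambda) * lambda ^+ k = e / lambda.
  by rewrite /e exprS; field.
rewrite eE in H1 H2; clearbody e; move: H1 H2 => {eE IH}.
set c := 1 - lambda; clearbody c.
rewrite !mulrDl !mulNr ![_ - c / lambda + _]addrAC.
lra.
Qed.

(** The intervals from [y k - h] to [y k] do not overlap, so their masses add up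
to at most the mass of the range that they span; likewise in the next lemma,
for increasing [y]. *)
Lemma sum_increments_decr_le n (y : nat -> R) h :
  (forall k, (k < n)%N -> y k.+1 <= y k - h) ->
  \sum_(k < n) (G (y k) - G (y k - h)) <= G (y 0%N) - G (y n).
Proof.
elim: n => [_|n IH hn]; first by rewrite big_ord0 subrr.
rewrite big_ord_recr /=.
have := IH (fun k kn => hn k (ltnW kn)); have := G_ndecr (hn n (ltnSn n)).
lra.
Qed.

Lemma sum_increments_incr_le n (y : nat -> R) h :
  (forall k, (k < n)%N -> y k <= y k.+1 - h) ->
  \sum_(k < n) (G (y k) - G (y k - h)) <= G (y n - h) - G (y 0%N - h).
Proof.
elim: n => [_|n IH hn]; first by rewrite big_ord0 subrr.
rewrite big_ord_recr /=.
have := IH (fun k kn => hn k (ltnW kn)); have := G_ndecr (hn n (ltnSn n)).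
lra.
Qed.

(** Shifting by the digits of index [k < n] bounds [n] times the increment at [x]
by two sums of increments over disjoint intervals, one on each side of [x]. *)
Lemma increment_small n : exists2 h, 0 < h &
  forall x, n%:R * (G x - G (x - h)) <= 2.
Proof.
pose e k := (1 - lambda) * lambda ^+ k.
have l1 : 0 < 1 - lambda by rewrite subr_gt0.
(* No two consecutive shifts among [e 0, ..., e n] are closer than this. *)
pose h := (1 - lambda) * e n.
have h0 : 0 < h by rewrite /h /e !mulr_gt0 ?exprn_gt0.
have eS k : (k < n)%N -> e k.+1 <= e k - h.
  move=> kn; rewrite lerBrDr -lerBrDl.
  have -> : e k - e k.+1 = (1 - lambda) * e k by rewrite /e exprS; ring.
  by rewrite !ler_pM2l // ler_wiXn2l ?ltW // ltnW.
exists h => // x.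
have H1 := @sum_increments_decr_le n (fun k => x + e k) h.
have H2 := @sum_increments_incr_le n (fun k => x - e k) h.
have {}H1 : \sum_(k < n) (G (x + e k) - G (x + e k - h)) <= 1.
  apply: le_trans (H1 _) _ => [k /eS /=|]; first lra.
  have := G_le1 (x + e 0%N); have := G_ge0 (x + e n); lra.
have {}H2 : \sum_(k < n) (G (x - e k) - G (x - e k - h)) <= 1.
  apply: le_trans (H2 _) _ => [k /eS /=|]; first lra.
  have := G_le1 (x - e n - h); have := G_ge0 (x - e 0%N - h); lra.
have := lerD H1 H2; rewrite -big_split /= => H.
rewrite -[n in n%:R]card_ord mulr_natl -sumr_const.
apply: le_trans H; apply: ler_sum => k _.
exact: increment_le_shift (ltW h0).
Qed.

Lemma self_similar_continuous : continuous G.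
Proof.
move=> x; apply/cvgrPdist_lt => e e0.
pose n := (Num.truncn (2 / e)).+1.
have [h h0 hG] := increment_small n.
have ne : 2 / e < n%:R by exact: Num.Theory.truncnS_gt.
have small y z : y <= z -> z - y <= h -> G z - G y < e.
  move=> yz zyh; have H2 := hG z.
  have H1 : G (z - h) <= G y by apply: G_ndecr; lra.
  have {}H2 : n%:R * (G z - G y) <= 2.
    by apply: le_trans H2; rewrite ler_wpM2l ?ler0n //; lra.
  rewrite ltr_pdivrMr // in ne.
  rewrite -(@ltr_pM2l _ n%:R) ?ltr0n //.
  exact: le_lt_trans H2 ne.
near=> y.
have : `|x - y| < h by near: y; exact: cvgr_dist_lt.
rewrite ltr_norml => /andP[xy1 xy2].
rewrite ltr_norml; apply/andP; split; have [xy|/ltW xy] := leP x y.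
- have := small _ _ xy; lra.
- have := G_ndecr xy; lra.
- have := G_ndecr xy; lra.
- have := small _ _ xy; lra.
Unshelve. all: by end_near. Qed.

Lemma exp_lt_eps e : 0 < e -> exists n, lambda ^+ n < e.
Proof.
move=> e0.
have : (lambda ^+ n @[n --> \oo]) --> (0 : R).
  by apply: cvg_expr; rewrite gtr0_norm.
move=> /cvgrPdist_lt /(_ _ e0) [n _ /(_ n (leqnn n))] /=.
by rewrite sub0r normrN gtr0_norm ?exprn_gt0 // => H; exists n.
Qed.

(** The branch [x |-> (x - (1 - lambda)) / lambda] fixes [1] and expands, so its
iterates carry any [x < 1] below [0], where [G] vanishes; each step loses at
most a factor [2] in [1 - G]. *)
Lemma self_similar_lt1 x : x < 1 -> G x < 1.
Proof.
rewrite -subr_gt0 => /exp_lt_eps [n].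
elim: n x => [|n IH] x; first by rewrite expr0 => x0; rewrite G_lt0 ?ltr01 //; lra.
rewrite exprSr -ltr_pdivlMr // => xn; rewrite G_split.
have := G_le1 (x / lambda).
suff : G ((x - (1 - lambda)) / lambda) < 1 by lra.
apply: IH; apply: lt_le_trans xn _.
by rewrite le_eqVlt; apply/orP; left; apply/eqP; field; rewrite gt_eqF.
Qed.

(** An interval that lies to the left of [lambda] or to the right of
[1 - lambda] is expanded inside the unit interval by one of the two branches,
which allows an induction on its length.  Otherwise it contains
[1 - lambda] and [lambda] and the branch [x |-> x / lambda] moves its right end
beyond [1] but keeps its left end below [1]. *)
Lemma self_similar_increasing x y : 0 <= x -> y <= 1 -> x < y -> G x < G y.
Proof.
move=> x0 y1; rewrite -subr_gt0 => /exp_lt_eps [n].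
elim: n x y x0 y1 => [|n IH] x y x0 y1; first by rewrite expr0; lra.
rewrite exprSr -ltr_pdivlMr // => xy; rewrite (G_split x) (G_split y).
have xy' : x < y.
  rewrite -subr_gt0 -(@pmulr_lgt0 _ (lambda^-1)) ?invr_gt0 //.
  by apply: le_lt_trans xy; rewrite exprn_ge0 // ltW.
have mono b : G ((x - b) / lambda) <= G ((y - b) / lambda).
  by apply: G_ndecr; rewrite ler_pM2r ?invr_gt0 //; lra.
have := mono 0; rewrite !subr0 => m0; have m1 := mono (1 - lambda).
have [yl|yl] := leP y lambda.
  suff : G (x / lambda) < G (y / lambda) by lra.
  apply: IH; rewrite ?divr_ge0 ?ler_pdivrMr ?mul1r // ?ltW //.
  by rewrite -mulrBl.
have [xl|xl] := leP (1 - lambda) x.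
  suff : G ((x - (1 - lambda)) / lambda) < G ((y - (1 - lambda)) / lambda) by lra.
  apply: IH.
  - by rewrite divr_ge0 ?subr_ge0 // ltW.
  - by rewrite ler_pdivrMr // mul1r; lra.
  - by rewrite -mulrBl (_ : _ - _ - _ = y - x) //; ring.
suff : G (x / lambda) < G (y / lambda) by lra.
rewrite (@G_ge1 (y / lambda)); last by rewrite ler_pdivlMr // mul1r ltW.
apply: self_similar_lt1; rewrite ltr_pdivrMr // mul1r.
move: lambda_gt; lra.
Qed.

End self_similar.

(** * Invariance under the tent map in the coordinate of a distribution function *)

Section tent_map.
Variables (R : realType) (nu : probability R R).
Let F (x : R) : R := fine (nu `]-oo, x]%classic).
Hypothesis F_continuous : continuous F.
Hypothesis F_lt0 : forall x, x < 0 -> F x = 0.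
Hypothesis F_1 : F 1 = 1.
Hypothesis F_incr : forall x y, 0 <= x -> y <= 1 -> x < y -> F x < F y.
Hypothesis F_sym : forall x, F (1 - x) = 1 - F x.

Let nuF x : nu `]-oo, x]%classic = (F x)%:E.
Proof. by rewrite /F fineK // fin_num_measure. Qed.

Let F_ndecr : {homo F : x y / x <= y}.
Proof.
move=> x y xy; rewrite -lee_fin -!nuF le_measure ?inE //.
by apply: subset_itvl.
Qed.

Let F_0 : F 0 = 0.
Proof. by rewrite -(subrr 1) F_sym F_1. Qed.

Let F_half : F 2^-1 = 2^-1.
Proof.
have := F_sym 2^-1; have -> : 1 - 2^-1 = 2^-1 :> R by field.
lra.
Qed.

Let F_ge0 x : 0 <= F x. Proof. exact: fine_ge0. Qed.

Let F_le1 x : F x <= 1.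
Proof. by rewrite -lee_fin -nuF probability_le1. Qed.

Let F_le0 x : x <= 0 -> F x = 0.
Proof. by move=> /F_ndecr; rewrite F_0 => Fx; apply/eqP; rewrite eq_le Fx F_ge0. Qed.

Let F_ge1 x : 1 <= x -> F x = 1.
Proof. by move=> /F_ndecr; rewrite F_1 => Fx; apply/eqP; rewrite eq_le Fx F_le1. Qed.

(** A continuous distribution function has no atoms. *)
Lemma open_ray_cdf x : nu `]-oo, x[%classic = (F x)%:E.
Proof.
apply/eqP; rewrite eq_le -nuF le_measure ?inE //=; last first.
  by apply: subset_itvl; rewrite bnd_simp.
rewrite nuF; have -> : nu `]-oo, x[%classic = (fine (nu `]-oo, x[%classic))%:E.
  by rewrite fineK // fin_num_measure.
rewrite lee_fin; apply/ler_addgt0Pl => e e0.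
have /cvgrPdist_lt /(_ _ e0) [d d0 dP] := @F_continuous x.
have xd : F (x - d / 2) <= fine (nu `]-oo, x[%classic).
  rewrite -lee_fin -nuF fineK ?fin_num_measure // le_measure ?inE //.
  by apply: subset_itvl; rewrite bnd_simp ltrBlDr ltrDl divr_gt0.
have := dP (x - d / 2); rewrite /= opprB addrC subrK gtr0_norm ?divr_gt0 //.
rewrite ltr_pdivrMr // ltr_pMr // ltr1n => /(_ isT).
rewrite ltr_norml => /andP[_]; lra.
Qed.

Lemma distribution_function_cdf : distribution_function nu = F.
Proof.
apply/funext => x; rewrite /distribution_function /F; congr fine.
have [x0|x0] := ltP x 0.
  by rewrite set_itv_ge ?measure0 ?nuF ?F_lt0 // bnd_simp -ltNge.
rewrite [RHS](_ : _ = nu (`]-oo, 0[ `|` `[0, x])).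
  rewrite measureU //=; last first.
    apply/seteqP; split=> y //=; rewrite !in_itv /= => -[y0 /andP[]].
    by rewrite leNgt y0.
  by rewrite open_ray_cdf F_0 add0e.
congr (nu _); apply/seteqP; split=> y /=; rewrite !in_itv /=.
  by move=> ->; rewrite andbT; case: (ltP y 0) => _; [left|right].
by case=> [/ltW /le_trans|/andP[]//]; exact.
Qed.

(** By the intermediate value theorem [F] maps the unit interval onto itself, so
the chosen inverse is a genuine right inverse. *)
Lemma distribution_function_invP v : 0 <= v <= 1 ->
  0 <= distribution_function_inv nu v <= 1 /\
  F (distribution_function_inv nu v) = v.
Proof.
move=> v01; rewrite /distribution_function_inv distribution_function_cdf.
have surj : set_surj `[0, 1] `[0, 1] F.
  move=> u /=; rewrite in_itv /= => u01.
  have [||c c01 <-] := @IVT R F 0 1 u ler01.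
  - exact: continuous_subspaceT.
  - by rewrite F_0 F_1 minEle maxEle ler01.
  - by exists c.
have v01' : v \in (`[0, 1]%classic : set R) by rewrite inE /= in_itv.
split; last exact: (surjpK _ surj v01').
have : (`[0, 1]%classic : set R) (pinv (`[0, 1]%classic : set R) F v).
  have sub := surjpinv_image_sub surj.
  by apply: sub; exists v => //; rewrite -inE.
by rewrite /= in_itv.
Qed.

(** As [F] is symmetric, this says that [F] turns [phi] into the tent map. *)
Lemma phi_cdf x : 0 <= phi nu x <= 1 /\
  F (phi nu x) = 2 * F (Order.min x (1 - x)).
Proof.
have half y : y <= 2^-1 -> 0 <= 2 * F y <= 1.
  by move=> /F_ndecr; rewrite F_half; have := F_ge0 y; lra.
rewrite /phi distribution_function_cdf; case: ifPn => [x2|].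
  rewrite min_l; last by lra.
  exact: distribution_function_invP (half _ x2).
rewrite -ltNge => x2; rewrite min_r; last by lra.
by apply: distribution_function_invP; apply: half; lra.
Qed.

(** The tent map has two branches, and each contributes one ray; the point [s]
is the preimage of [t] under the increasing branch. *)
Lemma phi_lt t : 0 < t <= 1 -> exists2 s, s <= 2^-1 & F s = F t / 2 /\
  phi nu @^-1` `]-oo, t[ = `]-oo, s[ `|` `]1 - s, +oo[.
Proof.
move=> /andP[t0 t1].
have Ft0 : 0 < F t by rewrite -F_0; apply: F_incr.
have Ft1 := F_le1 t.
have [|s01 Fs] := @distribution_function_invP (F t / 2); first lra.
move: (distribution_function_inv _ _) s01 Fs => s /andP[s0 s1] Fs.
have s2 : s <= 2^-1.
  rewrite leNgt; apply/negP => /(F_incr _ s1); rewrite invr_ge0 => /(_ (ler0n _ _)).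
  by rewrite Fs F_half; lra.
exists s => //; split=> //.
have tP x : (phi nu x < t) = (Order.min x (1 - x) < s).
  have [/andP[p0 p1] pE] := phi_cdf x.
  have -> : (phi nu x < t) = (F (phi nu x) < F t).
    apply/idP/idP => [|]; first exact: F_incr.
    by apply: contraTT; rewrite -!leNgt; exact: F_ndecr.
  have -> : F t = 2 * F s by rewrite Fs; field.
  rewrite pE ltr_pM2l //; set u := Order.min _ _.
  apply/idP/idP => [|us].
    by apply: contraTT; rewrite -!leNgt; exact: F_ndecr.
  (* [F] is only known to be strictly increasing on the unit interval, and [u]
  is negative when [x] lies outside of it. *)
  have [u0|u0] := leP 0 u; first exact: F_incr.
  by rewrite F_lt0 // Fs divr_gt0.
apply/seteqP; split=> x /=; rewrite !in_itv /= tP gt_min ?andbT.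
  by move=> /orP[|?]; [left|right; lra].
by case=> [->//|?]; apply/orP; right; lra.
Qed.

Lemma nu_phi_lt t : measurable (phi nu @^-1` `]-oo, t[) /\
  nu (phi nu @^-1` `]-oo, t[) = nu `]-oo, t[%classic.
Proof.
rewrite open_ray_cdf; have [t0|t0] := leP t 0.
  rewrite F_le0 // (_ : _ @^-1` _ = set0) ?measure0 //.
  apply/seteqP; split=> x //=; rewrite in_itv /=.
  by have [/andP[p0 _] _] := phi_cdf x; lra.
have [t1|t1] := leP t 1; last first.
  rewrite F_ge1 ?ltW // (_ : _ @^-1` _ = setT) ?probability_setT //.
  apply/seteqP; split=> x //=; rewrite in_itv /=.
  by have [/andP[_ p1] _] := phi_cdf x; lra.
have [|s s2 [Fs ->]] := @phi_lt t; first by rewrite t0.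
split; first exact: measurableU.
rewrite measureU //=; last first.
  by apply/seteqP; split=> x //=; rewrite !in_itv /= andbT; lra.
rewrite open_ray_cdf -setCitvl probability_setC // nuF F_sym Fs.
by rewrite -EFinB -EFinD; congr EFin; field.
Qed.

Lemma measurable_phi : measurable_fun setT (phi nu).
Proof.
apply: (measurability _ (RGenInftyO.measurableE R)) => _ [_ [t ->] <-].
by rewrite setTI; have [] := nu_phi_lt t.
Qed.

(** The open rays form a family that is closed under intersection and generates
the Borel sets, so the measures [nu] and its image under [phi] agree once they
agree on these rays. *)
Lemma phi_invariant A : measurable A -> nu (phi nu @^-1` A) = nu A.
Proof.
move=> mA.
have mphi := measurable_phi.
pose m : {measure set R -> \bar R} :=
  pushforward nu (phi nu).
have -> : nu (phi nu @^-1` A) = m mphi A by [].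
apply: (measure_unique (@RGenInftyO.G R) (fun n => `]-oo, n%:R[%classic)) => //.
- exact: RGenInftyO.measurableE.
- move=> _ _ [x ->] [y ->]; exists (Order.min x y).
  by apply/seteqP; split=> z /=; rewrite !in_itv /= lt_min => /andP.
- by move=> n; exists n%:R.
- apply/seteqP; split=> // x _; exists (Num.truncn x).+1 => //=.
  by rewrite in_itv /= Num.Theory.truncnS_gt.
- by move=> _ [t ->]; have [_] := nu_phi_lt t.
- move=> n; have [mn _] := nu_phi_lt n%:R.
  exact: le_lt_trans (probability_le1 nu mn) (ltry 1).
Qed.

End tent_map.

(** * Series of fair digits *)

Section digits.
Variables (R : realType) (lambda : R).

(** The partial sums of the normalised series are defined by recursion from the
first digit on, because the first digit is what self-similarity splits off. *)
Fixpoint digit_sum n (s : nat -> bool) : R :=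
  if n is n'.+1
  then (1 - lambda) * (s 0%N)%:R + lambda * digit_sum n' (fun i => s i.+1)
  else 0.

(** The distribution function of [digit_sum n] under fair digits
([prob_digit_sum_le]), without reference to a probability space. *)
Fixpoint digit_cdf n (x : R) : R :=
  if n is n'.+1
  then (digit_cdf n' (x / lambda) + digit_cdf n' ((x - (1 - lambda)) / lambda)) / 2
  else (0 <= x)%R%:R.

Definition digit_value (s : nat -> bool) : R :=
  (lambda^-1 - 1) * limn [series (s i)%:R * lambda ^+ i.+1]_i.

Hypothesis lambda_gt0 : 0 < lambda.
Hypothesis lambda_lt1 : lambda < 1.

Let lambda_neq0 : lambda != 0. Proof. by rewrite gt_eqF. Qed.

Lemma digit_sumE n s :
  digit_sum n s = (lambda^-1 - 1) * series (fun i => (s i)%:R * lambda ^+ i.+1) n.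
Proof.
rewrite /series /=; elim: n s => [|n IH] s /=; first by rewrite big_nil mulr0.
rewrite IH big_nat_recl //= expr1.
rewrite (_ : \sum_(0 <= i < n) (s i.+1)%:R * lambda ^+ i.+2 =
   lambda * \sum_(0 <= i < n) (s i.+1)%:R * lambda ^+ i.+1); first by field.
by rewrite mulr_sumr; apply: eq_bigr => i _; rewrite [in LHS]exprS mulrCA.
Qed.

Lemma digit_sum_ndecr s : nondecreasing_seq (digit_sum ^~ s).
Proof.
apply/nondecreasing_seqP => n; rewrite !digit_sumE.
rewrite ler_wpM2l //; first by rewrite subr_ge0 invf_ge1 // ltW.
by rewrite /series /= big_nat_recr //= lerDl mulr_ge0 // exprn_ge0 // ltW.
Qed.

Lemma digit_sum_cvg s : digit_sum n s @[n --> \oo] --> digit_value s.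
Proof.
rewrite (_ : digit_sum ^~ s = fun n => (lambda^-1 - 1) *
    series (fun i => (s i)%:R * lambda ^+ i.+1) n); last first.
  by apply/funext => n; exact: digit_sumE.
apply: cvgMr; apply: (@series_le_cvg _ _ (geometric lambda lambda)) => [n|n|n|].
- by rewrite mulr_ge0 // exprn_ge0 // ltW.
- by rewrite mulr_ge0 ?exprn_ge0 // ltW.
- by rewrite /= -exprS ler_piMl ?exprn_ge0 ?(ltW lambda_gt0) //; case: (s n).
- by apply: is_cvg_geometric_series; rewrite gtr0_norm.
Qed.

Lemma digit_value_leP s x : reflect (forall n, digit_sum n s <= x) (digit_value s <= x).
Proof.
have cs := cvgP _ (@digit_sum_cvg s).
rewrite -(cvg_lim _ (@digit_sum_cvg s)) //.
apply: (iffP idP) => [+ n|sx].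
  by apply: le_trans; exact: nondecreasing_cvgn_le (digit_sum_ndecr s) cs n.
by apply: limr_le => //; apply: nearW.
Qed.

Lemma digit_value_ge0 s : 0 <= digit_value s.
Proof. by have /digit_value_leP /(_ 0%N) := lexx (digit_value s). Qed.

Lemma digit_value_le1 s : digit_value s <= 1.
Proof.
apply/digit_value_leP => n; elim: n s => [|n IH] s //=.
have : lambda * digit_sum n (fun i => s i.+1) <= lambda by rewrite ler_piMr // ltW.
have : (1 - lambda) * (s 0%N)%:R <= 1 - lambda.
  by case: (s 0%N); rewrite ?mulr1 // mulr0 subr_ge0 ltW.
lra.
Qed.

(** The series with all digits equal to [1] has the value [1]. *)
Lemma digit_value_negb s : digit_value (fun i => ~~ s i) = 1 - digit_value s.
Proof.
have E n r : digit_sum n (fun i => ~~ r i) = 1 - lambda ^+ n - digit_sum n r.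
  elim: n r => [|n IH] r /=; first by rewrite expr0; ring.
  by rewrite (IH (fun i => r i.+1)) exprS; case: (r 0%N) => /=; ring.
have H : digit_sum n (fun i => ~~ s i) @[n --> \oo] --> 1 - 0 - digit_value s.
  under eq_fun do rewrite E.
  apply: cvgB (@digit_sum_cvg s); apply: cvgB; first exact: cvg_cst.
  by apply: cvg_expr; rewrite gtr0_norm.
by rewrite -(cvg_lim _ (@digit_sum_cvg _)) // (cvg_lim _ H) // subr0.
Qed.

Section law.
Context d (T : measurableType d) (P : probability T R).
Variable a : nat -> {RV P >-> bool}.
Hypothesis ha : fair_digits a.

Definition cylinder k (b : nat -> bool) : set T :=
  [set w | forall i, (i < k)%N -> a i w = b i].

Lemma cylinderE k b :
  cylinder k b = \bigcap_(i in [set` [fset i in iota 0 k]%fset]) a i @^-1` [set b i].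
Proof.
apply/seteqP; split=> w /= H i /=.
  by rewrite inE mem_iota /= add0n => /H.
by move=> ik; apply: H; rewrite /= inE mem_iota.
Qed.

Lemma measurable_cylinder k b : measurable (cylinder k b).
Proof.
rewrite cylinderE; apply: fin_bigcap_measurable => // i _.
exact: measurable_funPTI.
Qed.

Lemma prob_cylinder k b : P (cylinder k b) = (2^-1 ^+ k)%:E.
Proof.
have [fair indep] := ha.
rewrite cylinderE indep //.
rewrite (eq_bigr (fun=> (2^-1)%:E)) => [|i _]; last exact: fair.
rewrite prodEFin; congr EFin.
rewrite big_const_seq count_predT iter_mulr_1; congr (_ ^+ _).
by rewrite card_fseq undup_id ?iota_uniq // size_iota.
Qed.

Lemma measurable_digit_sum n k :
  measurable_fun setT (fun w => digit_sum n (fun i => a (k + i)%N w)).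
Proof.
elim: n k => [|n IH] k /=; first exact: measurable_cst.
apply: measurable_funD; apply: measurable_funM => //.
  have -> : (fun w => (a (k + 0)%N w)%:R) = (fun b : bool => b%:R : R) \o a (k + 0)%N by [].
  exact: measurableT_comp.
under eq_fun do under [X in digit_sum _ X]eq_fun do rewrite -addSnnS.
exact: IH.
Qed.

Lemma measurable_digit_sum_le n k x :
  measurable [set w | digit_sum n (fun i => a (k + i)%N w) <= x].
Proof.
have := measurable_digit_sum n k measurableT (measurable_itv `]-oo, x]).
by rewrite setTI; congr measurable.
Qed.

(** Intersecting with a cylinder over the first [k] digits expresses the
independence of these digits and the later ones in a form that suits an
induction on [n]: splitting on the digit of index [k] lengthens the cylinder and
shortens the sum. *)
Lemma prob_digit_sum_le n k b x :
  P (cylinder k b `&` [set w | digit_sum n (fun i => a (k + i)%N w) <= x]) =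
  (2^-1 ^+ k * digit_cdf n x)%:E.
Proof.
elim: n k b x => [|n IH] k b x /=.
  case: (leP 0 x) => x0.
    by rewrite [X in _ `&` X](_ : _ = setT) ?setIT ?prob_cylinder ?mulr1 //; apply/seteqP; split.
  by rewrite [X in _ `&` X](_ : _ = set0) ?setI0 ?measure0 ?mulr0 //; apply/seteqP; split.
(* The prescribed digits [b], extended by the value [c] at index [k]. *)
pose b' c i := if i == k then c else b i.
pose E c := cylinder k.+1 (b' c) `&`
  [set w | digit_sum n (fun i => a (k.+1 + i)%N w) <= (x - (1 - lambda) * c%:R) / lambda].
rewrite (_ : _ `&` _ = E false `|` E true); last first.
  have shift w : (fun i => a (k + i.+1)%N w) = (fun i => a (k.+1 + i)%N w).
    by apply/funext => i; rewrite addSnnS.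
  have cyl w c : cylinder k.+1 (b' c) w <-> cylinder k b w /\ a k w = c.
    split=> [H|[H akc] i].
      split; last by rewrite H // /b' eqxx.
      by move=> i ik; rewrite (H i (leqW ik)) /b' ltn_eqF.
    rewrite ltnS leq_eqVlt /b' => /predU1P[->|ik]; first by rewrite eqxx.
    by rewrite ltn_eqF // H.
  apply/seteqP; split=> w /=.
    rewrite addn0 shift => -[wb wx].
    suff : E (a k w) w by case: (a k w); [right|left].
    by split; [exact/cyl|rewrite /= ler_pdivlMr // mulrC lerBrDl].
  rewrite addn0 shift; case=> -[/cyl [wb ->]] /=;
   by rewrite ler_pdivlMr // mulrC lerBrDl.
have mE c : measurable (E c).
  apply: measurableI; first exact: measurable_cylinder.
  exact: measurable_digit_sum_le.
rewrite measureU //=.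
  by rewrite !IH -EFinD mulr0 subr0 mulr1; congr EFin; rewrite exprSr; field.
apply/seteqP; split=> w //= -[[/(_ k (ltnSn k)) + _] [/(_ k (ltnSn k)) + _]].
by rewrite /b' eqxx => ->.
Qed.

(** Partial sums increase, so the event for the series is the decreasing
intersection of the events for the partial sums. *)
Lemma digit_cdf_cvg x :
  (digit_cdf n x)%:E @[n --> \oo] --> P [set w | digit_value (fun i => a i w) <= x].
Proof.
pose D n := [set w | digit_sum n (fun i => a i w) <= x].
have PD n : P (D n) = (digit_cdf n x)%:E.
  have := prob_digit_sum_le n 0 (fun=> true) x.
  by rewrite expr0 mul1r (_ : cylinder _ _ = setT) ?setTI //; apply/seteqP; split.
have mD n : measurable (D n).
  exact: (measurable_digit_sum_le n 0).
under eq_fun do rewrite -PD.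
rewrite (_ : [set w | _] = \bigcap_n D n); last first.
  apply/seteqP; split=> w /=; first by move=> /digit_value_leP H n _; exact: H.
  by move=> H; apply/digit_value_leP => n; exact: H.
apply: nonincreasing_cvg_mu => //.
- exact: le_lt_trans (probability_le1 P (mD 0%N)) (ltry 1).
- exact: bigcapT_measurable.
- move=> m n mn; apply/subsetPset => w /=; apply: le_trans.
  exact: digit_sum_ndecr.
Qed.

End law.
End digits.

(** * The distribution function of the Bernoulli convolution *)

Section flip.
Context (R : realType) d (T : measurableType d) (P : probability T R).
Variable a : nat -> {RV P >-> bool}.

Definition flipped (i : nat) (w : T) : bool := ~~ a i w.

Lemma measurable_flipped i : measurable_fun setT (flipped i).
Proof. exact: measurable_neg. Qed.

HB.instance Definition _ i :=
  isMeasurableFun.Build _ _ _ _ (flipped i) (measurable_flipped i).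

Definition flip (i : nat) : {RV P >-> bool} := flipped i.

Lemma fair_flip : fair_digits a -> fair_digits flip.
Proof.
move=> [fair indep].
have E i B : flip i @^-1` B = a i @^-1` (negb @^-1` B) by [].
split=> [i b|J B mB].
  rewrite E -(fair i (~~ b)); congr (P (_ @^-1` _)).
  by apply/seteqP; split=> c /= => [<-|->]; rewrite negbK.
by under eq_bigcapr do rewrite E; rewrite indep.
Qed.

End flip.

Section law_of_series.
Context (R : realType) d (T : measurableType d) (P : probability T R).
Variables (lambda : R) (hlambda : 2^-1 < lambda < 1).

Let lambda_gt0 : 0 < lambda.
Proof. by case/andP: hlambda => + _; apply: lt_trans; rewrite invr_gt0. Qed.

Let lambda_lt1 : lambda < 1. Proof. by case/andP: hlambda. Qed.

Definition bernoulli_cdf (a : nat -> {RV P >-> bool}) (x : R) : R :=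
  fine (bernoulli_convolution a hlambda `]-oo, x]%classic).

Lemma bernoulli_convolution_rayE (a : nat -> {RV P >-> bool}) x :
  bernoulli_convolution a hlambda `]-oo, x]%classic =
  P [set w | digit_value lambda (fun i => a i w) <= x].
Proof. by congr (P _); apply/seteqP; split=> w; rewrite /= in_itv. Qed.

(** The left-hand side does not involve the digits: two families of fair digits
give the same law. *)
Lemma bernoulli_cdf_cvg a x : fair_digits a ->
  digit_cdf lambda n x @[n --> \oo] --> bernoulli_cdf a x.
Proof.
move=> ha; have := @digit_cdf_cvg _ _ lambda_gt0 lambda_lt1 _ _ _ _ ha x.
rewrite -bernoulli_convolution_rayE.
have -> : bernoulli_convolution a hlambda `]-oo, x]%classic = (bernoulli_cdf a x)%:E.
  by rewrite fineK // fin_num_measure.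
exact: fine_cvg.
Qed.

Lemma bernoulli_cdf_split (a : nat -> {RV P >-> bool}) x : fair_digits a ->
  bernoulli_cdf a x = (bernoulli_cdf a (x / lambda) +
    bernoulli_cdf a ((x - (1 - lambda)) / lambda)) / 2.
Proof.
move=> ha; have H := fun y => @bernoulli_cdf_cvg a y ha.
have H1 := H x; rewrite -cvg_shiftS in H1.
have H2 : digit_cdf lambda n.+1 x @[n --> \oo] --> (bernoulli_cdf a (x / lambda) +
    bernoulli_cdf a ((x - (1 - lambda)) / lambda)) / 2.
  by apply: cvgM; [exact: cvgD|exact: cvg_cst].
by rewrite -(cvg_lim _ H1) // (cvg_lim _ H2).
Qed.

Lemma bernoulli_cdf_lt0 a x : x < 0 -> bernoulli_cdf a x = 0.
Proof.
move=> x0; rewrite /bernoulli_cdf bernoulli_convolution_rayE.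
rewrite (_ : [set _ | _] = set0) ?measure0 //.
apply/seteqP; split=> w //=; apply/negP; rewrite -ltNge.
by apply: lt_le_trans x0 _; exact: digit_value_ge0.
Qed.

Lemma bernoulli_cdf_ge1 a x : 1 <= x -> bernoulli_cdf a x = 1.
Proof.
move=> x1; rewrite /bernoulli_cdf bernoulli_convolution_rayE.
rewrite (_ : [set _ | _] = setT) ?probability_setT //.
apply/seteqP; split=> w //= _.
by apply: le_trans x1; exact: digit_value_le1.
Qed.

Lemma bernoulli_cdf_ndecr a : {homo bernoulli_cdf a : x y / x <= y}.
Proof.
move=> x y xy; rewrite fine_le ?fin_num_measure // le_measure ?inE //.
exact: subset_itvl.
Qed.

Lemma bernoulli_cdf_continuous a : fair_digits a -> continuous (bernoulli_cdf a).
Proof.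
move=> ha; case/andP: hlambda => l2 l1.
apply: (@self_similar_continuous R lambda) => //.
- exact: bernoulli_cdf_ndecr.
- exact: bernoulli_cdf_lt0.
- exact: bernoulli_cdf_ge1.
- by move=> x; exact: bernoulli_cdf_split.
Qed.

(** Negating the digits gives the law of [1] minus the series, and the law is
unchanged because the negated digits are again fair.  Continuity turns the
open ray that appears by complementation into a closed one. *)
Lemma bernoulli_cdf_sym a x : fair_digits a ->
  bernoulli_cdf a (1 - x) = 1 - bernoulli_cdf a x.
Proof.
move=> ha; have hb := fair_flip ha.
have <- : bernoulli_cdf (flip a) x = bernoulli_cdf a x.
  by rewrite -(cvg_lim _ (@bernoulli_cdf_cvg _ x ha)) // (cvg_lim _ (@bernoulli_cdf_cvg _ x hb)).
suff : bernoulli_convolution (flip a) hlambda `]-oo, x]%classic =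
   (1 - bernoulli_cdf a (1 - x))%:E.
  move=> E; have -> : bernoulli_cdf (flip a) x = 1 - bernoulli_cdf a (1 - x).
    by rewrite /bernoulli_cdf [X in fine X]E.
  by ring.
rewrite EFinB -(open_ray_cdf (bernoulli_cdf_continuous ha)) -probability_setC //.
rewrite bernoulli_convolution_rayE; congr (P _); apply/seteqP; split=> w /=.
  rewrite digit_value_negb // in_itv /= => H; apply/negP; rewrite -leNgt.
  by rewrite lerBlDr addrC -lerBlDr.
rewrite digit_value_negb // in_itv /= => /negP; rewrite -leNgt.
by rewrite lerBlDr addrC -lerBlDr.
Qed.

End law_of_series.

(** * Invariance of the Bernoulli convolution *)

Unset Implicit Arguments.
Set Strict Implicit.

Theorem theorem2p1 (R : realType) (d : measure_display) (T : measurableType d)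
    (P : probability T R) (a : nat -> {RV P >-> bool}) (ha : fair_digits a)
    (lambda : R) (hlambda : 2^-1 < lambda < 1) :
  let nu := bernoulli_convolution a hlambda in
  forall A : set R, measurable A -> A `<=` `[0, 1] ->
    measurable (`[0, 1] `&` phi nu @^-1` A) /\
    nu (`[0, 1] `&` phi nu @^-1` A) = nu A.
Proof.
move=> nu A mA _.
pose F : R -> R := bernoulli_cdf hlambda a.
have Fc : continuous F by exact: bernoulli_cdf_continuous.
have F0 x : x < 0 -> F x = 0 by exact: bernoulli_cdf_lt0.
have F1 : F 1 = 1 by exact: bernoulli_cdf_ge1.
have Fsym x : F (1 - x) = 1 - F x by exact: bernoulli_cdf_sym.
have Fincr x y : 0 <= x -> y <= 1 -> x < y -> F x < F y.
  case/andP: (hlambda) => l2 l1; apply: (@self_similar_increasing R lambda) => //.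
  - exact: bernoulli_cdf_ndecr.
  - exact: bernoulli_cdf_ge1.
  - by move=> z; exact: bernoulli_cdf_split.
have mphi := measurable_phi Fc F0 F1 Fincr Fsym.
have mA' : measurable (phi nu @^-1` A).
  by rewrite -[X in measurable X]setTI; exact: mphi.
split; first exact: measurableI.
rewrite -(phi_invariant Fc F0 F1 Fincr Fsym mA) -/nu.
(* The restriction to the unit interval discards a null set only. *)
have nu01 : nu (~` `[0, 1]) = 0%E.
  rewrite probability_setC // -[X in (_ - X)%E]fineK ?fin_num_measure //.
  have -> : fine (nu `[0, 1]%classic) = F 1.
    have /(congr1 (fun f => f 1)) := distribution_function_cdf Fc F0 F1 Fsym.
    exact.
  by rewrite F1 subee.
have out0 : nu (phi nu @^-1` A `\` `[0, 1]) = 0%E.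
  apply: (@subset_measure0 _ _ _ nu _ (~` `[0, 1])) => //.
  - exact: measurableD.
  - exact: measurableC.
have -> : nu (phi nu @^-1` A) =
    (nu (phi nu @^-1` A `\` `[0%R, 1%R]) + nu (phi nu @^-1` A `&` `[0%R, 1%R]))%E.
  exact: measureDI.
by rewrite out0 add0e setIC.
Qed.
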